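(* For every simply-connected axisymmetric surface $\Sigma\subset\mathbb{R}^3$, $$\frac{1}{\operatorname{diam}(\Sigma)}\int_\Sigma|H|>\pi.$$ Moreover, if $\{\Sigma_n\}_n$ is a sequence of simply-connected axisymmetric surfaces such that $$\lim_{n\to\infty}\frac{1}{\operatorname{diam}(\Sigma_n)}\int_{\Sigma_n}|H|=\pi,$$ then, up to similarity (i.e. after applying to each $\Sigma_n$ a suitable similarity transformation of $\mathbb{R}^3$), a sequence $\{\gamma_{\Sigma_n}\}_n$ of generating curves of $\Sigma_n$ converges to a unit-speed segment $\bar\gamma:[0,1]\to\mathbb{R}^3$ in the sense of $W^{1,p}((0,1);\mathbb{R}^3)$ for every $1\le p<\infty$.
   Context: A surface is a closed surface smoothly immersed in $\mathbb{R}^3$ (not necessarily embedded). $H$ is the mean curvature, defined as the average of the two principal curvatures (so $|H|\equiv1$ on the unit sphere); integrals are with respect to the induced area measure. $\operatorname{diam}(\Sigma)$ is the extrinsic diameter, i.e. the maximal Euclidean distance in $\mathbb{R}^3$ between two points of $\Sigma$. A simply-connected axisymmetric surface is a connected, simply-connected surface (a topological sphere) that is rotationally symmetric around a line $L_{\mathrm{axis}}$. Up to a rigid motion it has the form $$\Sigma=\{(x(s)\cos\phi,\,x(s)\sin\phi,\,z(s)) : 0\le s\le L,\ 0\le\phi<2\pi\},$$ where $\gamma=(x,z):[0,L]\to\mathbb{R}^2$ is an immersed plane curve parametrized by arclength $s$, with $x(0)=z(0)=x(L)=0$, $z(L)\ge0$, $\gamma_s(0)=(1,0)$, $\gamma_s(L)=(-1,0)$,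 and $x(s)>0$ for $s\in(0,L)$; the $z$-axis is then $L_{\mathrm{axis}}$. A generating curve $\gamma_\Sigma:[0,1]\to\Sigma\subset\mathbb{R}^3$ is a constant-speed minimal geodesic in $\Sigma$ (with respect to the intrinsic metric) connecting the pair of points of $\Sigma$ on $L_{\mathrm{axis}}$ (the two poles), i.e. a meridian; it is unique up to revolution around the axis and choice of orientation (unless $\Sigma$ is a round sphere, where the axis is also a choice). In the coordinates above one may take $\gamma_\Sigma(t)=(x(Lt),0,z(Lt))$. *)

(* Defs.v *)
From HB Require Import structures.
From mathcomp Require Import all_boot all_order all_algebra.
From mathcomp Require Import all_classical all_reals all_analysis.

Set Implicit Arguments.
Unset Strict Implicit.
Unset Printing Implicit Defensive.
Import Order.TTheory GRing.Theory Num.Theory.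
Import numFieldNormedType.Exports.

Local Open Scope classical_set_scope.
Local Open Scope ring_scope.

Section EuclideanSpace.
Context {R : realType}.
Implicit Types u v : 'rV[R]_3.

Definition dotp u v : R := \sum_(i < 3) u 0 i * v 0 i.

(* The norm `|u| that 'rV[R]_3 carries in the library is the sup norm. *)
Definition enorm u : R := Num.sqrt (dotp u u).

Definition row3 (a b c : R) : 'rV[R]_3 := \row_i [tuple a; b; c]`_i.

Definition crossp u v : 'rV[R]_3 :=
  let x (w : 'rV[R]_3) (k : nat) := w 0 (inord k) in
  row3 (x u 1 * x v 2 - x u 2 * x v 1)
       (x u 2 * x v 0 - x u 0 * x v 2)
       (x u 0 * x v 1 - x u 1 * x v 0).

Definition orthogonal_mx (Q : 'M[R]_3) : Prop := Q *m Q^T = 1%:M.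

Definition is_similarity (T : 'rV[R]_3 -> 'rV[R]_3) : Prop :=
  exists (k : R) (Q : 'M[R]_3) (b : 'rV[R]_3),
    [/\ 0 < k, orthogonal_mx Q & forall u, T u = k *: (u *m Q) + b].

Definition diam (A : set 'rV[R]_3) : R :=
  sup [set enorm (p - q) | p in A & q in A].

End EuclideanSpace.

Section ParametrizedSurface.
Context {R : realType}.
Variable f : R -> R -> 'rV[R]_3.

Definition partial1 (g : R -> R -> 'rV[R]_3) (u v : R) : 'rV[R]_3 :=
  derive1 (g ^~ v) u.
Definition partial2 (g : R -> R -> 'rV[R]_3) (u v : R) : 'rV[R]_3 :=
  derive1 (g u) v.

Definition unit_normal (u v : R) : 'rV[R]_3 :=
  let n := crossp (partial1 f u v) (partial2 f u v) in (enorm n)^-1 *: n.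

Definition ffE u v : R := dotp (partial1 f u v) (partial1 f u v).
Definition ffF u v : R := dotp (partial1 f u v) (partial2 f u v).
Definition ffG u v : R := dotp (partial2 f u v) (partial2 f u v).

Definition sfL u v : R := dotp (partial1 (partial1 f) u v) (unit_normal u v).
Definition sfM u v : R := dotp (partial2 (partial1 f) u v) (unit_normal u v).
Definition sfN u v : R := dotp (partial2 (partial2 f) u v) (unit_normal u v).

(* The principal curvatures are the two roots k, both real when f is regular
   at (u, v), of  det (II - k I) = a k^2 - b k + c  with a, b, c as below. *)
Definition principal_curvature (eps : R) (u v : R) : R :=
  let a := ffE u v * ffG u v - ffF u v ^+ 2 in
  let b := sfL u v * ffG u v - 2 * (sfM u v * ffF u v) + sfN u v * ffE u v in
  let c := sfL u v * sfN u v - sfM u v ^+ 2 in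
  (b + eps * Num.sqrt (b ^+ 2 - 4 * a * c)) / (2 * a).

Definition mean_curvature u v : R :=
  (principal_curvature 1 u v + principal_curvature (-1) u v) / 2.

Definition area_density u v : R :=
  Num.sqrt (ffE u v * ffG u v - ffF u v ^+ 2).

End ParametrizedSurface.

Section AxisymmetricSphere.
Context {R : realType}.

Definition smooth (g : R -> R) : Prop :=
  forall (n : nat) (t : R), derivable (derive1n n g) t 1.

(* A simply-connected axisymmetric surface: the normal form generated by the
   curve (x, z), moved by the rigid motion  u |-> u *m Q + b.
   Only the values of x and z on [0, L] matter geometrically.  They are extended
   to the whole line by the reflections below, which determine the extension
   uniquely: the meridian, prolonged through a pole, continues on the opposite
   meridian, that is, with x replaced by - x.  Smoothness of the extended
   functions is exactly smoothness of the surface of revolution, poles included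
   (x odd and z even at both ends of [0, L]). *)
Record axisphere := AxiSphere {
  gen_x : R -> R;
  gen_z : R -> R;
  gen_L : R;
  motion_Q : 'M[R]_3;
  motion_b : 'rV[R]_3;
  gen_L_gt0 : 0 < gen_L;
  gen_x_smooth : smooth gen_x;
  gen_z_smooth : smooth gen_z;
  gen_x_odd0 : forall s, gen_x (- s) = - gen_x s;
  gen_z_even0 : forall s, gen_z (- s) = gen_z s;
  gen_x_oddL : forall s, gen_x (gen_L + s) = - gen_x (gen_L - s);
  gen_z_evenL : forall s, gen_z (gen_L + s) = gen_z (gen_L - s);
  gen_arclength : forall s, s \in `[0, gen_L] ->
    (derive1 gen_x s) ^+ 2 + (derive1 gen_z s) ^+ 2 = 1;
  gen_x0 : gen_x 0 = 0;
  gen_z0 : gen_z 0 = 0;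
  gen_xL : gen_x gen_L = 0;
  gen_zL : 0 <= gen_z gen_L;
  gen_dx0 : derive1 gen_x 0 = 1;
  gen_dz0 : derive1 gen_z 0 = 0;
  gen_dxL : derive1 gen_x gen_L = -1;
  gen_dzL : derive1 gen_z gen_L = 0;
  gen_x_gt0 : forall s, s \in `]0, gen_L[ -> 0 < gen_x s;
  motion_orthogonal : orthogonal_mx motion_Q
}.

Definition immersion (S : axisphere) (s phi : R) : 'rV[R]_3 :=
  row3 (gen_x S s * cos phi) (gen_x S s * sin phi) (gen_z S s) *m motion_Q S
  + motion_b S.

Definition surface_points (S : axisphere) : set 'rV[R]_3 :=
  [set immersion S s phi | s in `[0, gen_L S] & phi in `[0, 2 * pi[].

(* The parametrization is singular only at the two poles, a null set. *)
Definition total_abs_mean_curvature (S : axisphere) : \bar R :=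
  \int[(@lebesgue_measure R \x @lebesgue_measure R)%E]_(q in
      `[0, gen_L S]%classic `*` `[0, 2 * pi[%classic)
    (`|mean_curvature (immersion S) q.1 q.2|
     * area_density (immersion S) q.1 q.2)%:E.

(* Meridians at constant speed, in either orientation. *)
Definition generating_curve (S : axisphere) (c : R -> 'rV[R]_3) : Prop :=
  exists phi : R,
    (forall t, t \in `[0, 1] -> c t = immersion S (gen_L S * t) phi) \/
    (forall t, t \in `[0, 1] -> c t = immersion S (gen_L S * (1 - t)) phi).

End AxisymmetricSphere.

Arguments axisphere : clear implicits.

(* Sobolev convergence for curves ]0, 1[ -> R^3; functions are total on R but
   only their restriction to ]0, 1[ is used. *)
Section Sobolev.
Context {R : realType}.
Implicit Types (p : R) (u w : R -> 'rV[R]_3).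

Definition Lp_norm p u : \bar R :=
  ('N[@lebesgue_measure R]_(p%:E)
     [(fun t => (enorm (u t))%:E) \_ `]0%R, 1%R[%classic])%E.

Definition in_Lp p u : Prop :=
  (forall i, measurable_fun (`]0, 1[%classic : set R) (fun t : R => u t 0 i)) /\
  (Lp_norm p u < +oo)%E.

Definition test_function (eta : R -> R) : Prop :=
  smooth eta /\
  exists a b : R, [/\ 0 < a, b < 1 & forall t, t \notin `[a, b] -> eta t = 0].

Definition weak_derivative u w : Prop :=
  forall eta : R -> R, test_function eta -> forall i,
    \int[@lebesgue_measure R]_(t in `]0, 1[) (u t 0 i * derive1 eta t)
    = - \int[@lebesgue_measure R]_(t in `]0, 1[) (w t 0 i * eta t).

Definition in_W1p p u w : Prop :=
  [/\ in_Lp p u, in_Lp p w & weak_derivative u w].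

Definition cvg_W1p p (u_ : nat -> R -> 'rV[R]_3) u : Prop :=
  exists (w_ : nat -> R -> 'rV[R]_3) w,
    [/\ forall n, in_W1p p (u_ n) (w_ n),
        in_W1p p u w,
        Lp_norm p (fun t => u_ n t - u t) @[n --> \oo] --> 0%E
      & Lp_norm p (fun t => w_ n t - w t) @[n --> \oo] --> 0%E].

Definition unit_speed_segment (c : R -> 'rV[R]_3) : Prop :=
  exists a v : 'rV[R]_3,
    enorm v = 1 /\ forall t, t \in `[0, 1] -> c t = a + t *: v.

End Sobolev.

(* Main.v *)
Require Import Defs.
From HB Require Import structures.
From mathcomp Require Import all_boot all_order all_algebra.
From mathcomp Require Import all_classical all_reals all_analysis.
From mathcomp Require Import measurable_realfun ring lra.

(** Write [F = x (x' z'' - z' x'') + z'] for twice the mean curvature times the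
radius.  The area element is [x ds dphi], so the total absolute mean curvature
is [pi] times the integral of [|F|] over [[0, L]].  Two facts about the
generating curve carry the proof.

- The surface is a union of closed curves of length [2 L] (a meridian followed
  by the opposite one), and any two of its points are at most as far apart as
  two points of such a curve; hence the diameter is at most [L]
  ([diam_le_length]).

- The integral of [|F|] exceeds [L] by a definite amount.  Let [theta] be the
  tangent angle, [x' = cos theta], [z' = sin theta].  For any function [f],
  integrating [f'(theta) F] by parts, with [x = 0] at both ends, leaves the
  integral of [sin theta f'(theta) - cos theta f(theta)].  The choice
  [f = - cos theta] gives [L]; the choice
  [f = - cos theta - (cos theta)^3 / 6] still has [|f'| <= 1] and gives at
  least [L + K / 6], where [K] is the integral of [x'^2]
  ([integral_radial_curvature_ge]).

As [K > 0], the strict inequality follows.  If the ratio tends to [pi], then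
after rescaling to [L = 1] both [K -> 0] and [diam -> 1].  Smallness of [K]
keeps the surface close to the axis, so nearly all of the diameter must come
from the height; together with [z L >= 0] this forces [z L -> 1]
([height_defect_le]).  The deficit [d = 1 - z L] controls everything else: the
squared distance from the meridian to the unit segment on the axis is at most
[2 d] pointwise, and the squared distance of the velocities, whose integral is
exactly [2 d], tends to [0] in [L^1].  Both quantities are uniformly bounded,
so both convergences hold in every [L^p] ([Lp_norm_cvg0]). *)

Set Implicit Arguments.
Unset Strict Implicit.
Unset Printing Implicit Defensive.
Import Order.TTheory GRing.Theory Num.Theory.
Import numFieldNormedType.Exports.

Local Open Scope classical_set_scope.
Local Open Scope ring_scope.

(** * Calculus of continuously differentiable functions *)

Section C1Functions.
Context {R : realType}.
Implicit Types (f F : R -> R) (a b : R).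
Local Notation mu := (@lebesgue_measure R).

Lemma is_derive_continuous F f :
  (forall t : R, is_derive t 1 F (f t)) -> continuous F.
Proof.
move=> dF t; apply: differentiable_continuous.
by apply/derivable1_diffP; have := dF t => -[].
Qed.

Lemma continuous_integrable f a b :
  continuous f -> mu.-integrable `[a, b] (EFin \o f).
Proof.
move=> cf; apply: continuous_compact_integrable; first exact: segment_compact.
exact: continuous_subspaceT.
Qed.

Lemma integral_derive F f a b : a <= b ->
  (forall t : R, is_derive t 1 F (f t)) -> continuous f ->
  \int[mu]_(t in `[a, b]) f t = F b - F a.
Proof.
rewrite le_eqVlt => /predU1P[->|ab] dF cf.
  by rewrite set_itv1 Rintegral_set1 subrr.
have cF := is_derive_continuous dF.
rewrite /Rintegral (@continuous_FTC2 _ f F)//.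
- exact: continuous_subspaceT.
- split; [by move=> t _; have := dF t => -[]
         |exact/cvg_at_right_filter/cF|exact/cvg_at_left_filter/cF].
- by move=> t _; rewrite derive1E; have := dF t => -[].
Qed.

Lemma ge0_derive_le F f a b : a <= b ->
  (forall t : R, is_derive t 1 F (f t)) -> continuous f ->
  (forall t, t \in `[a, b] -> 0 <= f t) -> F a <= F b.
Proof.
move=> ab dF cf f0; rewrite -subr_ge0 -(integral_derive ab dF cf).
by apply: Rintegral_ge0 => t /= tab; apply: f0.
Qed.

Lemma integral_itvoo f a b : continuous f ->
  \int[mu]_(t in `]a, b[) f t = \int[mu]_(t in `[a, b]) f t.
Proof.
move=> cf.
have itf := continuous_integrable a b cf.
have itoc : mu.-integrable `]a, b] (EFin \o f).
  by apply: integrableS itf => //; exact: subset_itv_oc_cc.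
rewrite -(Rintegral_itv_obnd_cbnd itoc) Rintegral_itv_bndo_bndc//.
by apply: integrableS itf => //; exact: subset_itv_oo_cc.
Qed.

Lemma le_integral_continuous f g a b : continuous f -> continuous g ->
  (forall t, t \in `[a, b] -> f t <= g t) ->
  \int[mu]_(t in `[a, b]) f t <= \int[mu]_(t in `[a, b]) g t.
Proof.
move=> cf cg fg; apply: le_Rintegral => //; exact: continuous_integrable.
Qed.

Lemma integral_continuous_fin f a b : continuous f ->
  (\int[mu]_(t in `[a, b]) (f t)%:E)%E = (\int[mu]_(t in `[a, b]) f t)%:E.
Proof.
move=> cf; rewrite /Rintegral fineK//.
by apply: integrable_fin_num => //; exact: continuous_integrable.
Qed.

Lemma integral_subitv_ge0 f a b c : continuous f -> (forall t, 0 <= f t) ->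
  b <= c -> \int[mu]_(t in `[a, b]) f t <= \int[mu]_(t in `[a, c]) f t.
Proof.
move=> cf f0 bc; rewrite -lee_fin -!integral_continuous_fin//.
apply: ge0_subset_integral => //.
- by apply/measurable_EFinP/measurable_funTS; exact: continuous_measurable_fun.
- by move=> t _; rewrite lee_fin.
- by apply: subset_itvl; rewrite bnd_simp.
Qed.

(** The usual rules, with the functions in applied form, so that they fit the
expressions below without unfolding pointwise operations. *)
Lemma is_derive_add (f g : R -> R) (t df dg : R) :
  is_derive t 1 f df -> is_derive t 1 g dg ->
  is_derive t 1 (fun r => f r + g r) (df + dg).
Proof. by move=> ? ?; exact: is_deriveD. Qed.

Lemma is_derive_opp (f : R -> R) (t df : R) :
  is_derive t 1 f df -> is_derive t 1 (fun r => - f r) (- df).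
Proof. by move=> ?; exact: is_deriveN. Qed.

Lemma is_derive_mul (f g : R -> R) (t df dg : R) :
  is_derive t 1 f df -> is_derive t 1 g dg ->
  is_derive t 1 (fun r => f r * g r) (df * g t + f t * dg).
Proof.
move=> ? ?; rewrite addrC (mulrC df); exact: is_deriveM.
Qed.

Lemma is_derive_const (k t : R) : is_derive t 1 (fun _ : R => k) 0.
Proof. exact: is_derive_cst. Qed.

Lemma is_derive_mulr (f : R -> R) (t df k : R) :
  is_derive t 1 f df -> is_derive t 1 (fun r => f r * k) (df * k).
Proof.
move=> df'; have := is_derive_mul df' (is_derive_const k t).
by rewrite mulr0 addr0.
Qed.

Lemma is_derive_mull (f : R -> R) (t df k : R) :
  is_derive t 1 f df -> is_derive t 1 (fun r => k * f r) (k * df).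
Proof.
move=> df'; have := is_derive_mul (is_derive_const k t) df'.
by rewrite mul0r add0r.
Qed.

Lemma smooth_is_derive (g : R -> R) : smooth g ->
  forall n (t : R), is_derive t 1 (derive1n n g) (derive1n n.+1 g t).
Proof. by move=> sg n t; split; [exact: sg|rewrite derive1nS derive1E]. Qed.

Lemma smooth_continuous (g : R -> R) : smooth g ->
  forall n, continuous (derive1n n g).
Proof. by move=> sg n; exact: is_derive_continuous (smooth_is_derive sg n). Qed.

End C1Functions.

(** * Euclidean geometry of R^3 *)

Section Euclid.
Context {R : realType}.
Implicit Types (u v w : 'rV[R]_3) (Q : 'M[R]_3).

Lemma sum3 (f : 'I_3 -> R) :
  \sum_i f i = f 0 + f (inord 1) + f (inord 2).
Proof.
rewrite !big_ord_recr big_ord0 /= add0r.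
by congr (f _ + f _ + f _); apply: val_inj; rewrite /= ?inordK.
Qed.

Lemma dotpE u v : dotp u v = (u *m v^T) 0 0.
Proof. by rewrite mxE; apply: eq_bigr => i _; rewrite mxE. Qed.

Lemma dotp_mulmx Q u v : orthogonal_mx Q ->
  dotp (u *m Q) (v *m Q) = dotp u v.
Proof.
by move=> oQ; rewrite !dotpE trmx_mul mulmxA -(mulmxA u) oQ mulmx1.
Qed.

Lemma enorm_mulmx Q u : orthogonal_mx Q -> enorm (u *m Q) = enorm u.
Proof. by move=> oQ; rewrite /enorm dotp_mulmx. Qed.

Lemma row3E a b c : [/\ row3 a b c 0 0 = a :> R,
  row3 a b c 0 (inord 1) = b & row3 a b c 0 (inord 2) = c].
Proof. by rewrite !mxE/= !inordK. Qed.

Lemma dotp_row3 a b c a' b' c' :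
  dotp (row3 a b c) (row3 a' b' c') = a * a' + b * b' + c * c' :> R.
Proof.
by rewrite /dotp sum3; have [-> -> ->] := row3E a b c;
   have [-> -> ->] := row3E a' b' c'.
Qed.

Lemma enorm_row3 a b c :
  enorm (row3 a b c) = Num.sqrt (a ^+ 2 + b ^+ 2 + c ^+ 2) :> R.
Proof. by rewrite /enorm dotp_row3 !expr2. Qed.

Lemma enorm_ge0 u : 0 <= enorm u. Proof. exact: sqrtr_ge0. Qed.

Lemma dotp_ge0 u : 0 <= dotp u u.
Proof. by apply: sumr_ge0 => i _; rewrite -expr2 sqr_ge0. Qed.

Definition triple u v w : R := dotp u (crossp v w).

Lemma triple_row3 a b c a' b' c' a'' b'' c'' :
  triple (row3 a b c) (row3 a' b' c') (row3 a'' b'' c'') =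
  a * (b' * c'' - c' * b'') + b * (c' * a'' - a' * c'')
  + c * (a' * b'' - b' * a'').
Proof.
rewrite /triple /crossp dotp_row3.
rewrite (_ : inord 0 = 0); last by apply: val_inj; rewrite /= inordK.
by have [-> -> ->] := row3E a' b' c'; have [-> -> ->] := row3E a'' b'' c''.
Qed.

Lemma row3_eta u : u = row3 (u 0 0) (u 0 (inord 1)) (u 0 (inord 2)).
Proof.
apply/rowP => i; have [r0 r1 r2] := row3E (u 0 0) (u 0 (inord 1)) (u 0 (inord 2)).
case: (i) => -[|[|[|//]]] p3.
- by rewrite (_ : Ordinal p3 = 0) ?r0//; apply: val_inj.
- by rewrite (_ : Ordinal p3 = inord 1) ?r1//; apply: val_inj; rewrite /= inordK.
- by rewrite (_ : Ordinal p3 = inord 2) ?r2//; apply: val_inj; rewrite /= inordK.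
Qed.

(** The square of a triple product is the Gram determinant, hence depends on
scalar products only; this gives the invariance under isometries. *)
Lemma sqr_triple u v w : triple u v w ^+ 2 =
  dotp u u * dotp v v * dotp w w + 2 * (dotp u v * dotp v w * dotp u w)
  - dotp u u * dotp v w ^+ 2 - dotp v v * dotp u w ^+ 2
  - dotp w w * dotp u v ^+ 2.
Proof.
rewrite (row3_eta u) (row3_eta v) (row3_eta w) triple_row3 !dotp_row3.
by ring.
Qed.

Lemma normr_triple_mulmx Q u v w : orthogonal_mx Q ->
  `|triple (u *m Q) (v *m Q) (w *m Q)| = `|triple u v w|.
Proof.
move=> oQ; apply/eqP; rewrite -(@eqrXn2 _ 2)// !real_normK ?num_real//.
by rewrite !sqr_triple !dotp_mulmx.
Qed.

Lemma row3_lincomb k l (a b c a' b' c' : R) :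
  k *: row3 a b c + l *: row3 a' b' c' =
  row3 (k * a + l * a') (k * b + l * b') (k * c + l * c').
Proof.
rewrite [LHS]row3_eta !mxE/= !inordK//.
Qed.

Lemma row3B (a b c a' b' c' : R) :
  row3 a b c - row3 a' b' c' = row3 (a - a') (b - b') (c - c').
Proof.
rewrite -[row3 a b c]scale1r -scaleN1r row3_lincomb.
by rewrite !mul1r !mulN1r.
Qed.

Lemma row3Z (k a b c : R) : k *: row3 a b c = row3 (k * a) (k * b) (k * c).
Proof. by rewrite -[LHS]addr0 -(scale0r (row3 0 0 0)) row3_lincomb !mul0r !addr0. Qed.

Lemma sqr_enorm_row3 (a b c : R) : enorm (row3 a b c) ^+ 2 = a ^+ 2 + b ^+ 2 + c ^+ 2.
Proof. by rewrite enorm_row3 sqr_sqrtr// !addr_ge0 ?sqr_ge0. Qed.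

(** Lagrange's identity. *)
Lemma dotp_crossp u v : dotp (crossp u v) (crossp u v) =
  dotp u u * dotp v v - dotp u v ^+ 2.
Proof.
rewrite (row3_eta u) (row3_eta v); set a := u 0 0; set b := u 0 _; set c := u 0 _.
set a' := v 0 0; set b' := v 0 _; set c' := v 0 _; rewrite !dotp_row3 /crossp.
rewrite (_ : inord 0 = 0); last by apply: val_inj; rewrite /= inordK.
have [-> -> ->] := row3E a b c; have [-> -> ->] := row3E a' b' c'.
by ring.
Qed.

Lemma dotpDl u v w : dotp (u + v) w = dotp u w + dotp v w.
Proof. by rewrite !dotpE mulmxDl mxE. Qed.

Lemma dotpZl k u v : dotp (k *: u) v = k * dotp u v.
Proof. by rewrite !dotpE -scalemxAl mxE. Qed.

Lemma dotpC u v : dotp u v = dotp v u.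
Proof. by apply: eq_bigr => i _; rewrite mulrC. Qed.

Lemma dotpZr k u v : dotp u (k *: v) = k * dotp u v.
Proof. by rewrite dotpC dotpZl dotpC. Qed.

End Euclid.

(** * Mean curvature of a parametrized surface *)

Section MeanCurvature.
Context {R : realType}.

Lemma dotp_lincomb (A B C n : 'rV[R]_3) (E F G k : R) :
  dotp A (k *: n) * G - 2 * (dotp B (k *: n) * F) + dotp C (k *: n) * E =
  k * dotp (G *: A - (2 * F) *: B + E *: C) n.
Proof. by rewrite -(scaleNr (2 * F) B) !dotpDl !dotpZl !dotpZr; ring. Qed.

(** The half-sum of the two roots of [det (II - k I)] needs only the linear
coefficient of that polynomial, and the linear coefficient is a scalar product
with the normal.  The length of the unnormalized normal then cancels against
the area density, also where the parametrization is singular, since both sides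
are [0] there. *)
Lemma mean_curvature_area_density (f : R -> R -> 'rV[R]_3) s t :
  let a := ffE f s t * ffG f s t - ffF f s t ^+ 2 in
  `|mean_curvature f s t| * area_density f s t =
  `|triple (ffG f s t *: partial1 (partial1 f) s t
            - (2 * ffF f s t) *: partial2 (partial1 f) s t
            + ffE f s t *: partial2 (partial2 f) s t)
           (partial1 f s t) (partial2 f s t)| / (2 * a).
Proof.
move=> a; rewrite /mean_curvature /principal_curvature -/a.
set b := _ + sfN f s t * _; set n := crossp (partial1 f s t) (partial2 f s t).
have na : enorm n = Num.sqrt a by rewrite /enorm dotp_crossp.
have a0 : 0 <= a by rewrite /a -dotp_crossp dotp_ge0.
set w := (X in triple X).
have bE : b = (Num.sqrt a)^-1 * dotp w n.
  by rewrite -na /b /sfL /sfM /sfN dotp_lincomb.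
rewrite mul1r mulN1r -mulrDl addrACA subrr addr0 /area_density -/a /triple -/n.
rewrite (_ : (b + b) / (2 * a) / 2 = b / (2 * a)); last first.
  have [->|a1] := eqVneq a 0; first by rewrite mulr0 invr0 !mulr0 mul0r.
  by field; rewrite a1.
rewrite bE !normrM !normfV (ger0_norm (sqrtr_ge0 a)) normrM (ger0_norm a0).
rewrite (ger0_norm (ler0n _ _)).
have [->|a1] := eqVneq a 0; first by rewrite !mulr0 invr0 !mulr0 sqrtr0 mulr0.
have s1 : Num.sqrt a != 0 by rewrite sqrtr_eq0 -ltNge lt_neqAle eq_sym a1.
by field; rewrite a1.
Qed.

Lemma derive1_row3 (a b c : R -> R) (a' b' c' t : R) (Q : 'M[R]_3) d :
  is_derive t 1 a a' -> is_derive t 1 b b' -> is_derive t 1 c c' ->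
  derive1 (fun r => row3 (a r) (b r) (c r) *m Q + d) t = row3 a' b' c' *m Q.
Proof.
move=> da db dc.
have eE (x y z : R) (v : 'rV[R]_3) i j : (row3 x y z *m Q + v) i j =
    x * Q 0 j + y * Q (inord 1) j + z * Q (inord 2) j + v 0 j.
  rewrite ord1 mxE [X in X + _]mxE sum3.
  by have [-> -> ->] := row3E x y z.
pose f r := row3 (a r) (b r) (c r) *m Q + d.
have dfij i j : is_derive t 1 (fun r => f r i j)
    (a' * Q 0 j + b' * Q (inord 1) j + c' * Q (inord 2) j + 0).
  under eq_fun do rewrite eE.
  apply: is_derive_add.
  by apply: is_derive_add; [apply: is_derive_add; exact: is_derive_mulr|];
    exact: is_derive_mulr.
rewrite derive1E derive_mx; last first.
  by apply/derivable_mxP => i j; have [] := dfij i j.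
apply/matrixP => i j; rewrite mxE; have [_ ->] := dfij i j.
by rewrite -[row3 a' b' c' *m Q]addr0 eE mxE.
Qed.

Lemma row3_is_derive (a b c : R -> R) (a' b' c' t : R) i :
  is_derive t 1 a a' -> is_derive t 1 b b' -> is_derive t 1 c c' ->
  is_derive t 1 (fun r => row3 (a r) (b r) (c r) 0 i) (row3 a' b' c' 0 i).
Proof.
move=> da db dc; under eq_fun do rewrite mxE.
by rewrite mxE; case: i => -[|[|[|//]]] ?.
Qed.

Lemma row3_continuous (a b c : R -> R) i :
  continuous a -> continuous b -> continuous c ->
  continuous (fun r => row3 (a r) (b r) (c r) 0 i).
Proof.
move=> ca cb cc; under eq_fun do rewrite mxE.
by case: i => -[|[|[|//]]] ?.
Qed.

End MeanCurvature.

(** * Mean curvature of a surface of revolution *)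

Section Immersion.
Context {R : realType}.

Variable S : axisphere R.
Local Notation x := (gen_x S).
Local Notation z := (gen_z S).
Local Notation L := (gen_L S).
Local Notation Q := (motion_Q S).
Local Notation dx := (derive1 x).
Local Notation dz := (derive1 z).
Local Notation ddx := (derive1 dx).
Local Notation ddz := (derive1 dz).

Lemma gen_x_is_derive (t : R) : is_derive t 1 x (dx t).
Proof. exact: (smooth_is_derive (@gen_x_smooth _ S) 0). Qed.

Lemma gen_z_is_derive (t : R) : is_derive t 1 z (dz t).
Proof. exact: (smooth_is_derive (@gen_z_smooth _ S) 0). Qed.

Lemma gen_dx_is_derive (t : R) : is_derive t 1 dx (ddx t).
Proof. exact: (smooth_is_derive (@gen_x_smooth _ S) 1). Qed.

Lemma gen_dz_is_derive (t : R) : is_derive t 1 dz (ddz t).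
Proof. exact: (smooth_is_derive (@gen_z_smooth _ S) 1). Qed.

Lemma gen_x_continuous : continuous x.
Proof. exact: (@smooth_continuous _ _ (@gen_x_smooth _ S) 0). Qed.

Lemma gen_dx_continuous : continuous dx.
Proof. exact: (@smooth_continuous _ _ (@gen_x_smooth _ S) 1). Qed.

Lemma gen_dz_continuous : continuous dz.
Proof. exact: (@smooth_continuous _ _ (@gen_z_smooth _ S) 1). Qed.

Lemma gen_ddx_continuous : continuous ddx.
Proof. exact: (@smooth_continuous _ _ (@gen_x_smooth _ S) 2). Qed.

Lemma gen_ddz_continuous : continuous ddz.
Proof. exact: (@smooth_continuous _ _ (@gen_z_smooth _ S) 2). Qed.

Lemma partial1_immersion : partial1 (immersion S) =
  fun s phi => row3 (dx s * cos phi) (dx s * sin phi) (dz s) *m Q.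
Proof.
apply/funext => s; apply/funext => phi; apply: derive1_row3.
- exact/is_derive_mulr/gen_x_is_derive.
- exact/is_derive_mulr/gen_x_is_derive.
- exact: gen_z_is_derive.
Qed.

Lemma partial2_immersion : partial2 (immersion S) =
  fun s phi => row3 (x s * - sin phi) (x s * cos phi) 0 *m Q.
Proof.
apply/funext => s; apply/funext => phi.
exact: (@derive1_row3 _ _ _ (fun=> z s)).
Qed.

Lemma partial11_immersion : partial1 (partial1 (immersion S)) =
  fun s phi => row3 (ddx s * cos phi) (ddx s * sin phi) (ddz s) *m Q.
Proof.
rewrite partial1_immersion; apply/funext => s; apply/funext => phi.
rewrite /partial1; under eq_fun do rewrite -[row3 _ _ _ *m _]addr0.
apply: derive1_row3.
- exact/is_derive_mulr/gen_dx_is_derive.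
- exact/is_derive_mulr/gen_dx_is_derive.
- exact: gen_dz_is_derive.
Qed.

Lemma partial22_immersion : partial2 (partial2 (immersion S)) =
  fun s phi => row3 (x s * - cos phi) (x s * - sin phi) 0 *m Q.
Proof.
rewrite partial2_immersion; apply/funext => s; apply/funext => phi.
rewrite /partial2; under eq_fun do rewrite -[row3 _ _ _ *m _]addr0.
exact: (@derive1_row3 _ _ _ (fun=> 0)).
Qed.

(** Twice the mean curvature times the radius [x]: the principal curvatures are
[x' z'' - z' x''] along the meridian and [z' / x] across it. *)
Definition radial_curvature (s : R) : R :=
  x s * (dx s * ddz s - dz s * ddx s) + dz s.

Lemma gen_x_eq0 s : s \in `[0, L] -> x s = 0 -> s = 0 \/ s = L.
Proof.
rewrite in_itv/= => /andP[]; rewrite le_eqVlt => /predU1P[->|s0]; first by left.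
rewrite le_eqVlt => /predU1P[->|sL]; first by right.
by move=> xs; have := @gen_x_gt0 _ S s; rewrite in_itv/= s0 sL xs ltxx => /(_ isT).
Qed.

Lemma second_form_expand (r r' z' r'' z'' c s : R) :
  (r ^+ 2 * (r'' * c) + 1 * (r * - c)) * (r' * s * 0 - z' * (r * c))
  + (r ^+ 2 * (r'' * s) + 1 * (r * - s)) * (z' * (r * - s) - r' * c * 0)
  + (r ^+ 2 * z'' + 1 * 0) * (r' * c * (r * c) - r' * s * (r * - s))
  = (c ^+ 2 + s ^+ 2) * (r ^+ 2 * (r * (r' * z'' - z' * r'') + z')).
Proof. by ring. Qed.

(** At the poles the parametrization degenerates and the left-hand side is [0];
so is [radial_curvature], because [x] and [z'] vanish there.  The identity thus
holds on the closed interval without any exceptional null set. *)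
Lemma mean_curvature_immersion s phi : s \in `[0, L] ->
  `|mean_curvature (immersion S) s phi| * area_density (immersion S) s phi
  = `|radial_curvature s| / 2.
Proof.
move=> sL; have oQ := motion_orthogonal S.
have cs : cos phi ^+ 2 = 1 - sin phi ^+ 2 by rewrite cos2sin2.
have E1 : ffE (immersion S) s phi = 1.
  rewrite /ffE partial1_immersion dotp_mulmx// dotp_row3.
  by rewrite -(gen_arclength sL); ring: cs.
have F0 : ffF (immersion S) s phi = 0.
  rewrite /ffF partial1_immersion partial2_immersion dotp_mulmx// dotp_row3.
  by ring.
have G2 : ffG (immersion S) s phi = x s ^+ 2.
  by rewrite /ffG partial2_immersion dotp_mulmx// dotp_row3; ring: cs.
rewrite mean_curvature_area_density E1 F0 G2 mulr0 scale0r subr0 expr0n subr0.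
rewrite partial11_immersion partial22_immersion partial1_immersion.
rewrite partial2_immersion !scalemxAl -mulmxDl row3_lincomb.
rewrite normr_triple_mulmx// triple_row3.
rewrite second_form_expand cos2Dsin2 mul1r -/(radial_curvature s).
rewrite normrM normrX real_normK ?num_real// mul1r.
have [xs0|xs0] := eqVneq (x s) 0; last by field; rewrite xs0.
rewrite xs0 expr0n mul0r mul0r /radial_curvature xs0 mul0r add0r.
have [->|->] := gen_x_eq0 sL xs0.
  by rewrite gen_dz0 normr0 mul0r.
by rewrite gen_dzL normr0 mul0r.
Qed.

End Immersion.

(** * Lower bound for the total absolute mean curvature *)

Section ProductIntegral.
Context {R : realType}.
Local Notation mu := (@lebesgue_measure R).

Lemma integral_rectangle_fst (g : R -> R) (a b c d : R) :
  continuous g -> (forall t, 0 <= g t) -> c <= d ->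
  (\int[(mu \x mu)%E]_(q in `[a, b]%classic `*` `[c, d[%classic) (g q.1)%:E
   = ((d - c) * \int[mu]_(t in `[a, b]) g t)%:E)%E.
Proof.
move=> cg g0 cd.
have mg : measurable_fun setT (EFin \o g).
  by apply/measurable_EFinP; exact: continuous_measurable_fun.
have mD : measurable (`[a, b]%classic `*` `[c, d[%classic : set (R * R)).
  by apply: measurableX.
rewrite integral_mkcond fubini_tonelli1; first last.
- by move=> q; apply: erestrict_ge0 => ? _; rewrite lee_fin.
- apply/(measurable_restrictT _ mD)/measurable_funTS.
  by apply: (measurableT_comp mg); exact: measurable_fst.
transitivity (\int[mu]_(s in `[a, b]) ((d - c)%:E * (g s)%:E))%E.
  rewrite [RHS]integral_mkcond; apply: eq_integral => s _.
  rewrite /fubini_F patchE; case: ifPn => sab.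
    transitivity (\int[mu]_(y in `[c, d[) (g s)%:E)%E.
      rewrite [RHS]integral_mkcond; apply: eq_integral => y _.
      rewrite !patchE/= in_setX /= sab /=.
      by case: ifPn.
    rewrite integral_cst//= lebesgue_measure_itv/= lte_fin muleC.
    by move: cd; rewrite le_eqVlt => /predU1P[->|->]; rewrite ?ltxx ?subrr// EFinB.
  rewrite integral0_eq// => y _; rewrite patchE in_setX/=.
  by rewrite (negbTE sab).
rewrite ge0_integralZl//.
- by rewrite integral_continuous_fin// EFinM.
- exact: measurable_funTS.
- by move=> s _; rewrite lee_fin.
- by rewrite lee_fin subr_ge0.
Qed.

End ProductIntegral.

Section Calibration.
Context {R : realType}.
Implicit Types r u v a b : R.

(** Here [(u, v)] is the unit tangent.  In terms of the tangent angle, the weight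
[v (2 + u^2) / 2] is the derivative of [- cos theta - (cos theta)^3 / 6]; the
coefficient 1/6 is the largest for which the weight stays at most 1 near
[theta = pi / 2]. *)
Lemma calibration_weight_le1 u v : u ^+ 2 + v ^+ 2 = 1 ->
  `|v * (2 + u ^+ 2) / 2| <= 1.
Proof.
move=> uv; rewrite -(@ler_pXn2r _ 2)// ?nnegrE// expr1n real_normK ?num_real//.
rewrite -subr_ge0 (_ : _ - _ = (u ^+ 2) ^+ 2 * (3 + u ^+ 2) / 4).
  by rewrite divr_ge0// mulr_ge0 ?addr_ge0 ?sqr_ge0.
have -> : (v * (2 + u ^+ 2) / 2) ^+ 2 = v ^+ 2 * (2 + u ^+ 2) ^+ 2 / 4 by field.
by rewrite (_ : v ^+ 2 = 1 - u ^+ 2); [field|lra].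
Qed.

(** With [r = x], [(u, v) = (x', z')] and [(a, b) = (x'', z'')], the subtracted term
is the derivative of [x (x' + x'^3 / 6)], which integrates to [0] over a
meridian. *)
Lemma calibration_le r u v a b : u ^+ 2 + v ^+ 2 = 1 -> u * a + v * b = 0 ->
  1 + u ^+ 2 / 6 - (u * (u + u ^+ 3 / 6) + r * (a + a * u ^+ 2 / 2))
  <= `|r * (u * b - v * a) + v|.
Proof.
move=> uv ab.
have w1 := calibration_weight_le1 uv.
have Fw : (r * (u * b - v * a) + v) * (v * (2 + u ^+ 2) / 2)
    <= `|r * (u * b - v * a) + v|.
  apply: (le_trans (ler_norm _)); rewrite normrM.
  by rewrite -[leRHS]mulr1 ler_wpM2l.
apply: le_trans Fw.
have vb : v * b = - (u * a) by lra.
have vv : v ^+ 2 = 1 - u ^+ 2 by lra.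
have -> : (r * (u * b - v * a) + v) * (v * (2 + u ^+ 2) / 2) =
    (r * (u * (v * b) - v ^+ 2 * a) + v ^+ 2) * (2 + u ^+ 2) / 2 by field.
rewrite vb vv -subr_ge0 [leRHS](_ : _ = u ^+ 2 * (1 - u ^+ 2) / 3); last by field.
by rewrite -vv divr_ge0// mulr_ge0 ?sqr_ge0.
Qed.

End Calibration.

Section CurvatureBound.
Context {R : realType}.
Variable S : axisphere R.
Local Notation mu := (@lebesgue_measure R).
Local Notation x := (gen_x S).
Local Notation z := (gen_z S).
Local Notation L := (gen_L S).
Local Notation dx := (derive1 x).
Local Notation dz := (derive1 z).
Local Notation ddx := (derive1 dx).
Local Notation ddz := (derive1 dz).

(** Differentiating the arclength equation needs it in a neighbourhood, which the
open interval provides. *)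
Lemma gen_velocity_acceleration s : s \in `]0, L[ ->
  dx s * ddx s + dz s * ddz s = 0.
Proof.
move=> sI; have dE : is_derive s 1 (fun r => dx r * dx r + dz r * dz r)
    ((ddx s * dx s + dx s * ddx s) + (ddz s * dz s + dz s * ddz s)).
  by apply: is_derive_add; [exact: is_derive_mul (gen_dx_is_derive S s)
    (gen_dx_is_derive S s)|exact: is_derive_mul (gen_dz_is_derive S s)
    (gen_dz_is_derive S s)].
have E1 : \forall r \near s, 1 = dx r * dx r + dz r * dz r.
  near=> r; rewrite -!expr2 gen_arclength//.
  by apply: subset_itv_oo_cc; near: r; exact: near_in_itvoo.
have [_ d0] := near_eq_is_derive E1 (is_derive_const 1 s).
move: dE => [_]; rewrite d0.
by move: (dx s) (ddx s) (dz s) (ddz s) => a b c d ?; lra.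
Unshelve. all: by end_near. Qed.

Lemma radial_curvature_continuous : continuous (radial_curvature S).
Proof.
move=> t; apply: cvgD; last exact: gen_dz_continuous.
apply: cvgM; first exact: gen_x_continuous.
apply: cvgB; apply: cvgM.
- exact: gen_dx_continuous.
- exact: gen_ddz_continuous.
- exact: gen_dz_continuous.
- exact: gen_ddx_continuous.
Qed.

Lemma total_abs_mean_curvatureE : total_abs_mean_curvature S =
  (pi * \int[mu]_(s in `[0, L]) `|radial_curvature S s|)%:E.
Proof.
have cF : continuous (fun s => `|radial_curvature S s|).
  by move=> s; apply: cvg_norm; exact: radial_curvature_continuous.
rewrite /total_abs_mean_curvature.
transitivity (\int[(mu \x mu)%E]_(q in `[0%R, L]%classic `*`
    `[0%R, (2 * pi)%R[%classic) (`|radial_curvature S q.1| / 2)%R%:E)%E.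
  apply: eq_integral => -[s phi]; rewrite in_setX => /andP[/= sL _].
  by rewrite mean_curvature_immersion//; rewrite inE in sL.
rewrite (@integral_rectangle_fst _ (fun s => `|radial_curvature S s| / 2)).
- rewrite subr0 RintegralZr//; last exact: continuous_integrable.
  by congr (_%:E); field.
- by move=> s; apply: cvgMl; exact: cF.
- by move=> s; rewrite divr_ge0.
- by rewrite mulr_ge0// pi_ge0.
Qed.

(** The acceleration is orthogonal to the velocity only in the interior a priori;
at the poles the inequality is checked from the boundary values, the left-hand
side being exactly [0]. *)
Lemma radial_curvature_ge s : s \in `[0, L] ->
  1 + dx s ^+ 2 / 6 - (dx s * (dx s + dx s ^+ 3 / 6)
    + x s * (ddx s + ddx s * dx s ^+ 2 / 2)) <= `|radial_curvature S s|.
Proof.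
move=> sL.
have [s0|s0] := eqVneq s 0.
  by apply: le_trans (normr_ge0 _); rewrite s0 gen_x0 gen_dx0; lra.
have [s1|s1] := eqVneq s L.
  by apply: le_trans (normr_ge0 _); rewrite s1 gen_xL gen_dxL; lra.
have sI : s \in `]0, L[.
  by move: sL; rewrite !in_itv/= !le_eqVlt eq_sym (negPf s0) (negPf s1).
exact: calibration_le (@gen_arclength _ S _ sL) (gen_velocity_acceleration sI).
Qed.

Definition radial_energy : R := \int[mu]_(s in `[0, L]) dx s ^+ 2.

Lemma gen_dx_sqr_continuous : continuous (fun s => dx s ^+ 2).
Proof. by move=> s; apply: cvgM; exact: gen_dx_continuous. Qed.

Lemma integral_radial_curvature_ge :
  L + radial_energy / 6 <= \int[mu]_(s in `[0, L]) `|radial_curvature S s|.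
Proof.
have L0 : 0 <= L := ltW (gen_L_gt0 S).
have cF : continuous (fun s => `|radial_curvature S s|).
  by move=> s; apply: cvg_norm; exact: radial_curvature_continuous.
have cK := gen_dx_sqr_continuous.
pose P s := x s * (dx s + dx s ^+ 3 / 6).
pose P' s := dx s * (dx s + dx s ^+ 3 / 6) + x s * (ddx s + ddx s * dx s ^+ 2 / 2).
have dP (s : R) : is_derive s 1 P (P' s).
  apply: is_derive_mul (gen_x_is_derive S s) _.
  apply: is_derive_add; first exact: gen_dx_is_derive.
  rewrite (_ : _ / 2 = (3 * dx s ^+ 2 * ddx s) / 6).
    apply: is_derive_mulr.
    have := is_derive_mul (gen_dx_is_derive S s) (is_derive_mul
      (gen_dx_is_derive S s) (gen_dx_is_derive S s)).
    by move=> [? e]; split=> //; rewrite e; move: (dx s) (ddx s) => u v; ring.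
  by move: (dx s) (ddx s) => u v; field.
have cP' : continuous P'.
  move=> s; have cx := @gen_x_continuous _ S s.
  have cdx := @gen_dx_continuous _ S s; have cddx := @gen_ddx_continuous _ S s.
  apply: cvgD; apply: cvgM => //; apply: cvgD => //.
    by apply: cvgMl; do 2 apply: cvgM => //.
  by apply: cvgMl; do 2 apply: cvgM => //.
have PL : \int[mu]_(s in `[0, L]) P' s = 0.
  by rewrite (integral_derive L0 dP cP') /P gen_x0 gen_xL !mul0r subrr.
have : \int[mu]_(s in `[0, L]) (1 + dx s ^+ 2 / 6) <=
       \int[mu]_(s in `[0, L]) (`|radial_curvature S s| + P' s).
  apply: le_integral_continuous.
  - by move=> s; apply: cvgD; [exact: cvg_cst|apply: cvgMl; exact: cK].
  - by move=> s; apply: cvgD; [exact: cF|exact: cP'].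
  - by move=> s sL; rewrite -lerBlDr; exact: radial_curvature_ge.
have c1 : continuous (fun _ : R => 1 : R) by move=> s; exact: cvg_cst.
have cK6 : continuous (fun s => dx s ^+ 2 / 6) by move=> s; apply: cvgMl; exact: cK.
rewrite (RintegralD _ (continuous_integrable 0 L c1) (continuous_integrable 0 L cK6))//.
rewrite (RintegralD _ (continuous_integrable 0 L cF) (continuous_integrable 0 L cP'))//.
rewrite PL addr0 RintegralZr//; last exact: continuous_integrable cK.
by rewrite Rintegral_cst//= mul1r lebesgue_measure_itv/= lte_fin gen_L_gt0 sube0.
Qed.

(** Integrate [2 k x' <= k^2 + x'^2] from the pole; [k] is left free in order to
be balanced against the energy. *)
Lemma gen_x_le_energy (k s : R) : 0 <= k -> s \in `[0, L] ->
  2 * k * x s <= k ^+ 2 * L + radial_energy.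
Proof.
move=> k0; rewrite in_itv/= => /andP[s0 sL].
have cK := gen_dx_sqr_continuous.
have ck : continuous (fun t => k ^+ 2 + dx t ^+ 2).
  by move=> t; apply: cvgD; [exact: cvg_cst|exact: cK].
have dk (t : R) : is_derive t 1 (fun t => 2 * k * x t) (2 * k * dx t).
  by apply: is_derive_mull; exact: gen_x_is_derive.
have cdk : continuous (fun t => 2 * k * dx t).
  by move=> t; apply: cvgMr; exact: gen_dx_continuous.
have -> : 2 * k * x s = \int[mu]_(t in `[0, s]) (2 * k * dx t).
  by rewrite (integral_derive s0 dk cdk) gen_x0 mulr0 subr0.
apply: (@le_trans _ _ (\int[mu]_(t in `[0, s]) (k ^+ 2 + dx t ^+ 2))).
  apply: le_integral_continuous => // t _.
  by rewrite -subr_ge0 (_ : _ - _ = (k - dx t) ^+ 2) ?sqr_ge0//; ring.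
apply: (@le_trans _ _ (\int[mu]_(t in `[0, L]) (k ^+ 2 + dx t ^+ 2))).
  by apply: integral_subitv_ge0 => // t; rewrite addr_ge0 ?sqr_ge0.
rewrite RintegralD//; last 2 first.
- by apply: continuous_integrable => t; exact: cvg_cst.
- exact: continuous_integrable.
by rewrite Rintegral_cst//= lebesgue_measure_itv/= lte_fin gen_L_gt0 sube0.
Qed.

(** Otherwise [gen_x_le_energy], with [k] of the order of the radius at the
middle of the meridian, would make that radius vanish. *)
Lemma radial_energy_gt0 : 0 < radial_energy.
Proof.
have L0 := gen_L_gt0 S.
have mI : L / 2 \in `]0, L[ by rewrite in_itv/=; apply/andP; split; lra.
have x0 := @gen_x_gt0 _ S _ mI.
have k0 : 0 < x (L / 2) / L by rewrite divr_gt0.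
have := gen_x_le_energy (ltW k0) (subset_itv_oo_cc mI).
rewrite -lerBlDl; apply: lt_le_trans.
rewrite [ltRHS](_ : _ = x (L / 2) * (x (L / 2) / L)); first exact: mulr_gt0.
by field; rewrite gt_eqF.
Qed.

End CurvatureBound.

(** * Bounds for the diameter *)

Section Diameter.
Context {R : realType}.

(** Minkowski's inequality for [(a, b)] and [(c, - d)]. *)
Lemma plane_triangle (a b c d r t : R) : 0 <= r -> 0 <= t ->
  a ^+ 2 + b ^+ 2 <= r ^+ 2 -> c ^+ 2 + d ^+ 2 <= t ^+ 2 ->
  (a + c) ^+ 2 + (b - d) ^+ 2 <= (r + t) ^+ 2.
Proof.
move=> r0 t0 ab cd.
suff : a * c - b * d <= r * t by lra.
rewrite (le_trans (ler_norm _))// -(@ler_pXn2r _ 2)// ?nnegrE ?mulr_ge0//.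
rewrite real_normK ?num_real// exprMn.
apply: le_trans (ler_pM _ _ ab cd); rewrite ?addr_ge0 ?sqr_ge0//.
rewrite -subr_ge0 (_ : _ - _ = (a * d + b * c) ^+ 2) ?sqr_ge0//; ring.
Qed.

Variable S : axisphere R.
Local Notation x := (gen_x S).
Local Notation z := (gen_z S).
Local Notation L := (gen_L S).
Local Notation dx := (derive1 x).
Local Notation dz := (derive1 z).

Lemma gen_x_ge0 s : s \in `[0, L] -> 0 <= x s.
Proof.
rewrite in_itv/= => /andP[]; rewrite le_eqVlt => /predU1P[<-|s0].
  by rewrite gen_x0.
rewrite le_eqVlt => /predU1P[->|sL]; first by rewrite gen_xL.
by apply/ltW/gen_x_gt0; rewrite in_itv/= s0.
Qed.

(** The component of the velocity in the direction of the chord is at most 1. *)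
Lemma chord_le (s t : R) : 0 <= s -> s <= t -> t <= L ->
  (x t - x s) ^+ 2 + (z t - z s) ^+ 2 <= (t - s) ^+ 2.
Proof.
move=> s0 st tL; set a := x t - x s; set b := z t - z s.
pose r := Num.sqrt (a ^+ 2 + b ^+ 2).
have r2 : r ^+ 2 = a ^+ 2 + b ^+ 2 by rewrite sqr_sqrtr// addr_ge0 ?sqr_ge0.
have r0 : 0 <= r by exact: sqrtr_ge0.
have dh (u : R) : is_derive u 1 (fun u => r * u - (a * x u + b * z u))
    (r * 1 - (a * dx u + b * dz u)).
  exact: (is_derive_add (is_derive_mull r (is_derive_id u 1)) (is_derive_opp
    (is_derive_add (is_derive_mull a (gen_x_is_derive S u))
                   (is_derive_mull b (gen_z_is_derive S u))))).
have ch : continuous (fun u => r * 1 - (a * dx u + b * dz u)).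
  move=> u; apply: cvgB; first exact: cvg_cst.
  by apply: cvgD; apply: cvgMr; [exact: gen_dx_continuous|exact: gen_dz_continuous].
have : r * s - (a * x s + b * z s) <= r * t - (a * x t + b * z t).
  apply: (ge0_derive_le st dh ch) => u; rewrite in_itv/= => /andP[su ut].
  have /(@gen_arclength _ S) : u \in `[0, L].
    by rewrite in_itv/= (le_trans s0 su) (le_trans ut).
  move: (dx u) (dz u) => p q pq; rewrite mulr1 subr_ge0.
  rewrite (le_trans (ler_norm _))// -(@ler_pXn2r _ 2)// ?nnegrE//.
  rewrite real_normK ?num_real// r2 -[leRHS]mulr1 -pq -subr_ge0.
  by rewrite (_ : _ - _ = (a * q - b * p) ^+ 2) ?sqr_ge0//; ring.
rewrite -subr_ge0 (_ : _ - _ = r * (t - s) - r ^+ 2); last first.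
  by rewrite r2 /a /b; ring.
rewrite subr_ge0 expr2 -r2 => rr.
have ts : 0 <= t - s by rewrite subr_ge0.
rewrite ler_pXn2r// ?nnegrE//.
have [->//|rn0] := eqVneq r 0.
by rewrite -(@ler_pM2l _ r)// lt_neqAle eq_sym rn0.
Qed.

(** Turning one of the two points to the meridian opposite to the other only
increases their distance. *)
Lemma enorm_immersionB s1 s2 phi1 phi2 :
  s1 \in `[0, L] -> s2 \in `[0, L] ->
  enorm (immersion S s1 phi1 - immersion S s2 phi2) <=
  Num.sqrt ((x s1 + x s2) ^+ 2 + (z s1 - z s2) ^+ 2).
Proof.
move=> /gen_x_ge0 x1 /gen_x_ge0 x2.
rewrite /immersion opprD addrACA subrr addr0 -mulmxBl.
rewrite (enorm_mulmx _ (motion_orthogonal S)).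
rewrite -[X in _ - X]scale1r -scaleNr -[X in X + _]scale1r row3_lincomb enorm_row3.
rewrite ler_wsqrtr//.
move: (x s1) (x s2) (z s1) (z s2) x1 x2 => a b c d a0 b0.
have := cos2Dsin2 phi1; have := cos2Dsin2 phi2.
move: (cos phi1) (sin phi1) (cos phi2) (sin phi2) => p q p' q' pq' pq.
rewrite -subr_ge0 [leRHS](_ : _ = a * b * ((p + p') ^+ 2 + (q + q') ^+ 2)
  + (a ^+ 2 + a * b) * (1 - (p ^+ 2 + q ^+ 2))
  + (b ^+ 2 + a * b) * (1 - (p' ^+ 2 + q' ^+ 2))); last by ring.
by rewrite pq pq' subrr !mulr0 !addr0 !mulr_ge0 ?addr_ge0 ?sqr_ge0.
Qed.

Lemma diam_set_neq0 : [set enorm (p - q) | p in surface_points S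
  & q in surface_points S] !=set0.
Proof.
have pS : surface_points S (immersion S 0 0).
  exists 0; first by rewrite /= in_itv/= lexx ltW ?gen_L_gt0.
  by exists 0 => //=; rewrite in_itv/= lexx mulr_gt0 ?pi_gt0.
by exists (enorm (immersion S 0 0 - immersion S 0 0)); exists (immersion S 0 0) => //;
  exists (immersion S 0 0).
Qed.

Section UpperBound.
Variable m : R.
Hypothesis m0 : 0 <= m.
Hypothesis xzm : forall s t, s \in `[0, L] -> t \in `[0, L] ->
  (x s + x t) ^+ 2 + (z s - z t) ^+ 2 <= m ^+ 2.

Lemma diam_ubound : ubound [set enorm (p - q) | p in surface_points S
  & q in surface_points S] m.
Proof.
move=> _ [_ [s sL [phi _] <-] [_ [t tL [psi _] <-] <-]].
apply: (le_trans (enorm_immersionB _ _ sL tL)).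
by rewrite -(ger0_norm m0) -sqrtr_sqr ler_wsqrtr// xzm.
Qed.

Lemma diam_surface_le : diam (surface_points S) <= m.
Proof. exact: ge_sup diam_set_neq0 diam_ubound. Qed.

End UpperBound.

(** Two points on opposite meridians are joined by a path through the pole
[s = 0], of length [s + t], and by one through the other pole, of length
[2 L - s - t]; one of the two is at most [L]. *)
Lemma spread_le_length s t : s \in `[0, L] -> t \in `[0, L] ->
  (x s + x t) ^+ 2 + (z s - z t) ^+ 2 <= L ^+ 2.
Proof.
rewrite !in_itv/= => /andP[s0 sL] /andP[t0 tL].
have L0 := gen_L_gt0 S.
have below (r : R) : 0 <= r -> r <= L -> x r ^+ 2 + z r ^+ 2 <= r ^+ 2.
  move=> r0 rL; have := chord_le (lexx 0) r0 rL.
  by rewrite gen_x0 gen_z0 !subr0.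
have above (r : R) : 0 <= r -> r <= L ->
    x r ^+ 2 + (z L - z r) ^+ 2 <= (L - r) ^+ 2.
  by move=> r0 rL; have := chord_le r0 rL (lexx L); rewrite gen_xL sub0r sqrrN.
have [st|st] := leP (s + t) L.
  apply: (le_trans (plane_triangle s0 t0 (below s s0 sL) (below t t0 tL))).
  by rewrite ler_pXn2r// ?nnegrE ?addr_ge0// ltW.
have s0' : 0 <= L - s by rewrite subr_ge0.
have t0' : 0 <= L - t by rewrite subr_ge0.
have := plane_triangle s0' t0' (above s s0 sL) (above t t0 tL).
rewrite (_ : z L - z s - (z L - z t) = - (z s - z t)); last by ring.
rewrite sqrrN => /le_trans; apply.
by rewrite ler_pXn2r// ?nnegrE ?(ltW L0)//; lra.
Qed.

Lemma diam_le_length : diam (surface_points S) <= L.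
Proof. by apply: diam_surface_le spread_le_length; exact/ltW/gen_L_gt0. Qed.

Lemma diam_gt0 : 0 < diam (surface_points S).
Proof.
have L0 := gen_L_gt0 S.
have mI : L / 2 \in `]0, L[ by rewrite in_itv/=; apply/andP; split; lra.
have x0 := @gen_x_gt0 _ S _ mI.
apply: (@lt_le_trans _ _ (enorm (immersion S (L / 2) 0 - immersion S 0 0))).
  rewrite /immersion opprD addrACA subrr addr0 -mulmxBl.
  rewrite (enorm_mulmx _ (motion_orthogonal S)).
  rewrite -[X in _ - X]scale1r -scaleNr -[X in X + _]scale1r row3_lincomb enorm_row3.
  rewrite sqrtr_gt0 cos0 sin0 gen_x0 gen_z0 !(mulr1, mulr0, mul1r, addr0).
  by rewrite -addrA ltr_wpDr ?addr_ge0 ?sqr_ge0// exprn_gt0.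
apply: ub_le_sup.
  by exists L; apply: (diam_ubound (ltW L0)); exact: spread_le_length.
have z2 : (0 : R) \in `[0, 2 * pi[ by rewrite in_itv/= lexx mulr_gt0 ?pi_gt0.
exists (immersion S (L / 2) 0).
  by exists (L / 2); [exact: subset_itv_oo_cc|exists 0].
exists (immersion S 0 0) => //.
by exists 0; [rewrite /= in_itv/= lexx ltW|exists 0].
Qed.

Lemma gen_z_lipschitz (s t : R) : 0 <= s -> s <= t -> t <= L ->
  `|z t - z s| <= t - s.
Proof.
move=> s0 st tL; have ts : 0 <= t - s by rewrite subr_ge0.
rewrite -(@ler_pXn2r _ 2)// ?nnegrE// real_normK ?num_real//.
by apply: le_trans (chord_le s0 st tL); rewrite lerDr sqr_ge0.
Qed.

(** As height is 1-Lipschitz in arclength, a height difference [h] between two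
points of the meridian leaves only length [L - h] for the rest of it, so the
poles differ in height by at least [2 h - L], with the sign of the difference.
A descent of more than [L / 2] is excluded by [0 <= z L]. *)
Lemma height_diff_le s t : s \in `[0, L] -> t \in `[0, L] ->
  `|z s - z t| <= (L + z L) / 2.
Proof.
have half (r u : R) : 0 <= r -> r <= u -> u <= L -> `|z u - z r| <= (L + z L) / 2.
  move=> r0 ru uL; have zL0 := gen_zL S.
  have := gen_z_lipschitz (lexx 0) r0 (le_trans ru uL).
  have := gen_z_lipschitz r0 ru uL.
  have := gen_z_lipschitz (le_trans r0 ru) uL (lexx L).
  rewrite gen_z0 !ler_norml => /andP[? ?] /andP[? ?] /andP[? ?].
  by apply/andP; split; lra.
rewrite !in_itv/= => /andP[s0 sL] /andP[t0 tL].
have [st|/ltW ts] := leP s t; last exact: half.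
by rewrite distrC; exact: half.
Qed.

Lemma diam_le_height m : (forall s, s \in `[0, L] -> x s <= m) ->
  diam (surface_points S) <= 2 * m + (L + z L) / 2.
Proof.
move=> xm; have L0 := gen_L_gt0 S; have zL0 := gen_zL S.
have m0 : 0 <= m.
  have /xm : 0 \in `[0, L] by rewrite in_itv/= lexx ltW.
  by rewrite gen_x0.
apply: diam_surface_le => [|s t sI tI]; first lra.
have := height_diff_le sI tI; have := xm _ sI; have := xm _ tI.
have := gen_x_ge0 sI; have := gen_x_ge0 tI.
set h := (L + z L) / 2; rewrite -[(z s - z t) ^+ 2]real_normK ?num_real//.
move: `|z s - z t| (normr_ge0 (z s - z t)) (x s) (x t) => b b0 a c a0 c0 am cm bh.
have ac : a + c <= 2 * m by lra.
have h0 : 0 <= h by apply: le_trans bh.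
apply: (@le_trans _ _ ((a + c + b) ^+ 2)).
  rewrite -subr_ge0 (_ : _ - _ = 2 * ((a + c) * b)); last by ring.
  by rewrite !mulr_ge0// addr_ge0.
by rewrite ler_pXn2r// ?nnegrE ?lerD// !addr_ge0// mulr_ge0.
Qed.

(** By [integral_radial_curvature_ge] the assumption holds as soon as the total
absolute mean curvature is at most [(1 + k^2) pi] times the diameter.  It yields [K <= 6 k^2 L], hence [x <= 7/2 k L] by
[gen_x_le_energy], and [diam_le_height] does the rest. *)
Lemma height_defect_le (k : R) : 0 < k -> k <= 1 ->
  L + radial_energy S / 6 <= (1 + k ^+ 2) * diam (surface_points S) ->
  L - z L <= 16 * k * L.
Proof.
move=> k0 k1 LK; have L0 := gen_L_gt0 S.
have DL := diam_le_length; have K0 := radial_energy_gt0 S.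
set D := diam _ in LK DL; set K := radial_energy S in LK K0.
have k2 : 0 <= k ^+ 2 by rewrite sqr_ge0.
have kD : k ^+ 2 * D <= k ^+ 2 * L by rewrite ler_wpM2l.
have kL : k ^+ 2 * L <= k * L.
  by rewrite ler_wpM2r ?(ltW L0)// expr2 ler_piMl// ltW.
have KL : K <= 6 * (k ^+ 2 * L) by lra.
have xm s : s \in `[0, L] -> x s <= 7 / 2 * (k * L).
  move=> sI; have := gen_x_le_energy (ltW k0) sI; rewrite -/K => xk.
  rewrite -(@ler_pM2l _ (2 * k)) ?mulr_gt0//; apply: (le_trans xk).
  by rewrite (_ : 2 * k * _ = 7 * (k ^+ 2 * L)); [lra|field].
have := diam_le_height xm; rewrite -/D; move: (z L) => zL; lra.
Qed.

End Diameter.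

(** * Sobolev convergence *)

Section LpNorm.
Context {R : realType}.
Local Notation mu := (@lebesgue_measure R).
Implicit Types (u w : R -> 'rV[R]_3) (p : R).

Lemma measurable_enorm u :
  (forall i, measurable_fun (`]0, 1[%classic : set R) (fun t : R => u t 0 i)) ->
  measurable_fun (`]0, 1[%classic : set R) (fun t : R => enorm (u t)).
Proof.
move=> mu_; rewrite /enorm.
apply: (measurableT_comp (continuous_measurable_fun (@sqrt_continuous R))).
rewrite /dotp; apply: measurable_sum => i.
by apply: measurable_funM; exact: mu_.
Qed.

Lemma Lp_norm_le p u (h : R -> R) m : 0 < p -> 0 <= m ->
  (forall i, measurable_fun (`]0, 1[%classic : set R) (fun t : R => u t 0 i)) ->
  continuous h ->
  (forall t, t \in `]0, 1[ -> enorm (u t) `^ p <= h t) ->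
  \int[mu]_(t in `[0, 1]) h t <= m `^ p ->
  (Lp_norm p u <= m%:E)%E.
Proof.
move=> p0 m0 mu_ ch uh hm; rewrite /Lp_norm unlock /Lnorm.
have h0 t : t \in `]0, 1[ -> 0 <= h t.
  by move=> /uh; apply: le_trans; exact: powR_ge0.
have mh : measurable_fun (`]0%R, 1%R[%classic : set R) (EFin \o h).
  by apply/measurable_EFinP/measurable_funTS; exact: continuous_measurable_fun.
suff I : (\int[mu]_t (`|((fun t : R => (enorm (u t))%:E) \_ `]0%R, 1%R[) t| `^ p)
    <= (m `^ p)%:E)%E.
  have -> : m%:E = ((m `^ p)%:E `^ p^-1)%E.
    by rewrite poweR_EFin -powRrM divff ?gt_eqF// powRr1.
  apply: gt0_ler_poweR => //; rewrite ?invr_ge0 ?(ltW p0)//.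
    by rewrite in_itv/= leey andbT; apply: integral_ge0 => t _; exact: poweR_ge0.
  by rewrite in_itv/= leey andbT lee_fin powR_ge0.
rewrite -lee_fin -(integral_continuous_fin _ _ ch) in hm.
apply: le_trans hm.
have -> : (\int[mu]_(t in `[0%R, 1%R]) (h t)%:E =
           \int[mu]_(t in `]0%R, 1%R[) (h t)%:E)%E.
  by rewrite integral_itv_bndoo.
rewrite [leLHS](_ : _ = \int[mu]_(t in `]0%R, 1%R[) (enorm (u t) `^ p)%:E)%E.
  apply: ge0_le_integral => //.
  - by move=> t _; rewrite lee_fin powR_ge0.
  - apply/measurable_EFinP; apply: (measurableT_comp (measurable_powR p)).
    exact: measurable_enorm.
rewrite [RHS]integral_mkcond; apply: eq_integral => t _.
rewrite !patchE; case: ifPn => _.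
  by rewrite gee0_abs ?lee_fin ?enorm_ge0// poweR_EFin.
by rewrite abse0 poweR_EFin powR0 ?gt_eqF.
Qed.

Lemma powR_le_mul (a p : R) : 0 <= a <= 2 -> 1 <= p -> a `^ p <= 2 `^ p * a.
Proof.
move=> /andP[a0 a2] p1; have p0 : 0 < p by apply: lt_le_trans p1.
have {1}-> : a = 2 * (a / 2) by field.
rewrite powRM//; last by rewrite divr_ge0.
rewrite ler_wpM2l ?powR_ge0//.
move: a0; rewrite le_eqVlt => /predU1P[<-|a0]; first by rewrite mul0r powR0 ?gt_eqF.
apply: (@le_trans _ _ (a / 2)); last lra.
apply: ge1r_powR => //; lra.
Qed.

(** For functions with values in [[0, 2]], convergence in [L^2] implies convergence
in every [L^p], because [a^p <= 2^p a] there and [a <= k + a^2 / k] for every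
[k > 0].  The hypothesis is on a continuous majorant [q_] of the squares, so
that integrals are only taken of continuous functions. *)
Lemma Lp_norm_cvg0 p (g_ : nat -> R -> 'rV[R]_3) (q_ : nat -> R -> R) : 1 <= p ->
  (forall n i, measurable_fun (`]0, 1[%classic : set R) (fun t : R => g_ n t 0 i)) ->
  (forall n, continuous (q_ n)) ->
  (forall n t, t \in `]0, 1[ -> enorm (g_ n t) ^+ 2 <= q_ n t <= 4) ->
  \int[mu]_(t in `[0, 1]) q_ n t @[n --> \oo] --> (0 : R) ->
  Lp_norm p (g_ n) @[n --> \oo] --> 0%E.
Proof.
move=> p1 mg cq gq q0; have p0 : 0 < p by apply: lt_le_trans p1.
have bound e : 0 < e -> \forall n \near \oo, (Lp_norm p (g_ n) <= e%:E)%E.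
  (* [k] makes both halves of the bound [A k + A / k * k^2] equal to [e^p / 2]. *)
  move=> e0; pose A : R := 2 `^ p; pose k := e `^ p / (2 * A).
  have A0 : 0 < A by exact: powR_gt0.
  have ep0 : 0 < e `^ p by exact: powR_gt0.
  have k0 : 0 < k by rewrite divr_gt0// mulr_gt0.
  near=> n.
  have qn : \int[mu]_(t in `[0, 1]) q_ n t <= k ^+ 2.
    near: n; move/cvgrPdist_le: q0 => /(_ (k ^+ 2)).
    rewrite exprn_gt0// => /(_ isT); apply: filterS => n.
    by rewrite sub0r normrN; apply: le_trans; exact: ler_norm.
  have ch : continuous (fun t => A * k + A / k * q_ n t).
    by move=> t; apply: cvgD; [exact: cvg_cst|apply: cvgMr; exact: cq].
  apply: (@Lp_norm_le _ _ (fun t => A * k + A / k * q_ n t)) => //.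
  - exact: ltW.
  - move=> t /(gq n) /andP[]; move: (enorm (g_ n t)) (enorm_ge0 (g_ n t)).
    move=> a a0 aq q4; have a2 : a <= 2.
      by rewrite -(@ler_pXn2r _ 2)// ?nnegrE//; lra.
    apply: (le_trans (powR_le_mul _ p1)); first by rewrite a0.
    rewrite -/A -mulrA -mulrDr ler_pM2l//.
    rewrite -(@ler_pM2l _ k)// mulrDr (mulrA k k^-1) divff ?gt_eqF// mul1r.
    by have := sqr_ge0 (k - a); nra.
  - have c1 : continuous (fun _ : R => A * k) by move=> t; exact: cvg_cst.
    have c2 : continuous (fun t => A / k * q_ n t).
      by move=> t; apply: cvgMr; exact: cq.
    rewrite (RintegralD _ (continuous_integrable 0 1 c1)
      (continuous_integrable 0 1 c2))//.
    rewrite Rintegral_cst//= lebesgue_measure_itv/= lte_fin ltr01 sube0 mulr1.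
    rewrite RintegralZl//; last exact: (continuous_integrable 0 1 (cq n)).
    apply: (@le_trans _ _ (A * k + A / k * k ^+ 2)).
      by rewrite lerD2l ler_wpM2l// divr_ge0// ltW.
    rewrite (_ : _ + _ = 2 * A * k); last by field; rewrite gt_eqF.
    by rewrite /k mulrCA divff ?mulr1// gt_eqF// mulr_gt0.
have N0 n : (0 <= Lp_norm p (g_ n))%E by exact: Lnorm_ge0.
apply/fine_cvgP; split.
  near=> n; rewrite ge0_fin_numE//.
  by apply: (@le_lt_trans _ _ 1%:E); [near: n; exact: bound|exact: ltry].
apply/cvgrPdist_le => e e0; near=> n.
have Le : (Lp_norm p (g_ n) <= e%:E)%E by near: n; exact: bound.
rewrite sub0r normrN ger0_norm ?fine_ge0// -lee_fin fineK//.
by rewrite ge0_fin_numE//; apply: (le_lt_trans Le); exact: ltry.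
Unshelve. all: by end_near. Qed.

Lemma in_Lp_bounded p u : 1 <= p ->
  (forall i, measurable_fun (`]0, 1[%classic : set R) (fun t : R => u t 0 i)) ->
  (forall t, t \in `]0, 1[ -> enorm (u t) <= 1) -> in_Lp p u.
Proof.
move=> p1 mu_ u1; split=> //; have p0 : 0 < p by apply: lt_le_trans p1.
apply: (@le_lt_trans _ _ 1%:E); last exact: ltry.
apply: (@Lp_norm_le _ _ (fun=> 1)) => //.
- by move=> t; exact: cvg_cst.
- move=> t /u1 ut; apply: (@le_trans _ _ (1 `^ p)); last by rewrite powR1.
  by apply: ge0_ler_powR => //; rewrite ?nnegrE ?enorm_ge0// ltW.
- by rewrite Rintegral_cst//= lebesgue_measure_itv/= lte_fin ltr01 sube0 mulr1 powR1.
Qed.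

Lemma C1_weak_derivative u w :
  (forall i (t : R), is_derive t 1 (fun t => u t 0 i) (w t 0 i)) ->
  (forall i, continuous (fun t => w t 0 i)) -> weak_derivative u w.
Proof.
move=> du cw eta [seta [a [b [a0 b1 etaab]]]] i.
have eta0 : eta 0 = 0 by apply: etaab; rewrite in_itv/= leNgt a0.
have eta1 : eta 1 = 0.
  by apply: etaab; rewrite in_itv/= [X in _ && X]leNgt b1 andbF.
have de := smooth_is_derive seta 0; have ceta := @smooth_continuous _ _ seta 0.
have cde := @smooth_continuous _ _ seta 1.
rewrite /= in de ceta cde.
have cu := is_derive_continuous (du i).
have c1 : continuous (fun t => w t 0 i * eta t).
  by move=> t; apply: cvgM; [exact: cw|exact: ceta].
have c2 : continuous (fun t => u t 0 i * derive1 eta t).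
  by move=> t; apply: cvgM; [exact: cu|exact: cde].
have c12 : continuous (fun t => w t 0 i * eta t + u t 0 i * derive1 eta t).
  by move=> t; apply: cvgD; [exact: c1|exact: c2].
have := integral_derive ler01 (fun t => is_derive_mul (du i t) (de t)) c12.
rewrite (RintegralD _ (continuous_integrable 0 1 c1)
  (continuous_integrable 0 1 c2))// eta0 eta1 !mulr0 subrr => /eqP.
by rewrite addrC addr_eq0 !integral_itvoo// => /eqP.
Qed.

End LpNorm.

(** * The meridian rescaled to length one *)

Section NormalizedMeridian.
Context {R : realType}.
Local Notation mu := (@lebesgue_measure R).

(** Inverse of the rigid motion of [S], followed by the homothety that brings
the meridians to unit length. *)
Definition normalize (S : axisphere R) (u : 'rV[R]_3) : 'rV[R]_3 :=
  (gen_L S)^-1 *: (u *m (motion_Q S)^T)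
  + (- (gen_L S)^-1 *: (motion_b S *m (motion_Q S)^T)).

Variable S : axisphere R.
Local Notation x := (gen_x S).
Local Notation z := (gen_z S).
Local Notation L := (gen_L S).
Local Notation dx := (derive1 x).
Local Notation dz := (derive1 z).

Lemma normalize_similarity : is_similarity (normalize S).
Proof.
exists L^-1, (motion_Q S)^T, (- L^-1 *: (motion_b S *m (motion_Q S)^T)); split=> //.
  by rewrite invr_gt0 gen_L_gt0.
by rewrite /orthogonal_mx trmxK; apply: mulmx1C; exact: motion_orthogonal.
Qed.

Definition meridian (t : R) := immersion S (L * t) 0.

Definition normalized_meridian (t : R) : 'rV[R]_3 :=
  row3 (x (L * t) / L) 0 (z (L * t) / L).

Definition normalized_velocity (t : R) : 'rV[R]_3 :=
  row3 (dx (L * t)) 0 (dz (L * t)).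

Definition height_defect : R := 1 - z L / L.

Lemma normalize_meridian t : normalize S (meridian t) = normalized_meridian t.
Proof.
rewrite /normalize /meridian /immersion cos0 sin0 mulmxDl -mulmxA.
rewrite (_ : motion_Q S *m (motion_Q S)^T = 1%:M); last exact: motion_orthogonal.
rewrite mulmx1 scalerDr scaleNr addrK row3Z /normalized_meridian.
by rewrite !mulr0 mulr1 !(mulrC L^-1).
Qed.

Let L0 : 0 < L := gen_L_gt0 S.

Lemma scale_itv t : t \in `[0, 1] -> L * t \in `[0, L].
Proof.
by rewrite !in_itv/= => /andP[t0 t1]; rewrite mulr_ge0 ?(ltW L0)// ler_piMr// ltW.
Qed.

Lemma is_derive_rescale (f f' : R -> R) : (forall t : R, is_derive t 1 f (f' t)) ->
  forall t : R, is_derive t 1 (fun t => f (L * t) / L) (f' (L * t)).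
Proof.
move=> df t.
have dL : is_derive t 1 (fun t : R => L * t) (L * 1).
  exact: is_derive_mull L (is_derive_id t 1).
have := is_derive_mulr L^-1 (is_derive1_comp (df (L * t)) dL).
by rewrite mulr1 -mulrA divff ?gt_eqF// mulr1.
Qed.

Lemma continuous_rescale (f : R -> R) : continuous f -> continuous (fun t => f (L * t)).
Proof.
move=> cf t; apply: (@continuous_comp _ _ _ (fun t => L * t) f); last exact: cf.
by apply: cvgMr; exact: cvg_id.
Qed.

Lemma normalized_meridian_is_derive i (t : R) :
  is_derive t 1 (fun t => normalized_meridian t 0 i) (normalized_velocity t 0 i).
Proof.
apply: (@row3_is_derive _ _ (fun=> 0)).
- exact: is_derive_rescale (gen_x_is_derive S) t.
- exact: is_derive_rescale (gen_z_is_derive S) t.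
Qed.

Lemma normalized_velocity_continuous i : continuous (fun t => normalized_velocity t 0 i).
Proof.
apply: (@row3_continuous _ _ (fun=> 0)).
- exact: continuous_rescale (@gen_dx_continuous _ S).
- by move=> t; exact: cvg_cst.
- exact: continuous_rescale (@gen_dz_continuous _ S).
Qed.

Lemma height_defect_bounds : 0 <= height_defect <= 1.
Proof.
have := gen_z_lipschitz (lexx 0) (ltW L0) (lexx L).
rewrite gen_z0 !subr0 ler_norml => /andP[_ zL].
rewrite /height_defect subr_ge0 ler_pdivrMr// mul1r zL.
by rewrite lerBlDr lerDl divr_ge0 ?gen_zL// ltW.
Qed.

(** With [s = L t], arclength dominates the chord, so [x^2 + z^2 <= s^2], and
[x^2 + (z - s)^2 <= 2 s (s - z)]; moreover [s - z s] is nondecreasing in [s]. *)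
Lemma normalized_meridian_near t : t \in `]0, 1[ ->
  enorm (normalized_meridian t - t *: row3 0 0 1) ^+ 2 <= 2 * height_defect.
Proof.
move=> tI; have := scale_itv (subset_itv_oo_cc tI).
rewrite row3Z row3B sqr_enorm_row3 !mulr0 !subr0 mulr1 expr0n addr0.
have Ln : L != 0 by rewrite gt_eqF.
rewrite (_ : z (L * t) / L - t = (z (L * t) - L * t) / L); last first.
  by rewrite mulrBl [in RHS]mulrAC divff// mul1r.
rewrite /height_defect; move: (L * t) => s; rewrite in_itv/= => /andP[s0 sL].
have := chord_le (lexx 0) s0 sL; rewrite gen_x0 gen_z0 !subr0.
have := gen_z_lipschitz s0 sL (lexx L); rewrite ler_norml => /andP[_].
rewrite !expr_div_n -mulrDl ler_pdivrMr ?exprn_gt0//.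
rewrite (_ : 2 * (1 - z L / L) * L ^+ 2 = 2 * L * (L - z L)); last by field.
have := height_defect_bounds; rewrite /height_defect subr_ge0 ler_pdivrMr// mul1r.
move: (z L) (x s) (z s) => zL a b /andP[zLL _] h ab.
apply: (@le_trans _ _ (2 * s * (s - b))); first by lra.
apply: (@le_trans _ _ (2 * s * (L - zL))).
  by rewrite ler_wpM2l ?mulr_ge0//; lra.
by rewrite ler_wpM2r ?subr_ge0// ler_wpM2l.
Qed.

Lemma normalized_velocity_near t : t \in `]0, 1[ ->
  enorm (normalized_velocity t - row3 0 0 1) ^+ 2 = 2 - 2 * dz (L * t).
Proof.
move=> tI; have /(@gen_arclength _ S) := scale_itv (subset_itv_oo_cc tI).
rewrite row3B sqr_enorm_row3 !subr0 expr0n addr0.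
by move: (dx _) (dz _) => a b ab; lra.
Qed.

Lemma enorm_normalized_velocity t : t \in `]0, 1[ -> enorm (normalized_velocity t) = 1.
Proof.
move=> tI; have := @gen_arclength _ S _ (scale_itv (subset_itv_oo_cc tI)).
by rewrite enorm_row3 expr0n addr0 => ->; rewrite sqrtr1.
Qed.

Lemma enorm_normalized_meridian t : t \in `]0, 1[ -> enorm (normalized_meridian t) <= 1.
Proof.
move=> tI; have := scale_itv (subset_itv_oo_cc tI).
rewrite -(@ler_pXn2r _ 2) ?nnegrE ?enorm_ge0// sqr_enorm_row3.
move: (L * t) => s; rewrite in_itv/= => /andP[s0 sL].
have := chord_le (lexx 0) s0 sL; rewrite gen_x0 gen_z0 !subr0 => h.
rewrite expr0n addr0 !expr_div_n -mulrDl expr1n ler_pdivrMr ?exprn_gt0// mul1r.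
by apply: (le_trans h); rewrite ler_pXn2r// ?nnegrE// ltW.
Qed.

Lemma integral_velocity_defect :
  \int[mu]_(t in `[0, 1]) (2 - 2 * dz (L * t)) = 2 * height_defect.
Proof.
have d (t : R) : is_derive t 1 (fun t => 2 * t - 2 * (z (L * t) / L))
    (2 * 1 - 2 * dz (L * t)).
  exact: (is_derive_add (is_derive_mull 2 (is_derive_id t 1)) (is_derive_opp
    (is_derive_mull 2 (is_derive_rescale (gen_z_is_derive S) t)))).
rewrite mulr1 in d.
rewrite (integral_derive ler01 d).
  rewrite /height_defect mulr1 mulr0 mulr0 gen_z0 mul0r mulr0 subr0 subr0.
  by rewrite mulr1 mulrBr mulr1.
move=> t; apply: cvgB; first exact: cvg_cst.
by apply: cvgMr; exact: continuous_rescale (@gen_dz_continuous _ S) t.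
Qed.

End NormalizedMeridian.

(** * Inequality and convergence *)

Section Conclusion.
Context {R : realType}.
Local Notation mu := (@lebesgue_measure R).

Lemma measurable_components (u : R -> 'rV[R]_3) :
  (forall i, continuous (fun t => u t 0 i)) ->
  forall i, measurable_fun (`]0, 1[%classic : set R) (fun t : R => u t 0 i).
Proof.
by move=> cu i; apply: measurable_funTS; exact: continuous_measurable_fun (cu i).
Qed.

Lemma measurable_componentsB (u w : R -> 'rV[R]_3) :
  (forall i, continuous (fun t => u t 0 i)) ->
  (forall i, continuous (fun t => w t 0 i)) ->
  forall i, measurable_fun (`]0, 1[%classic : set R) (fun t : R => (u t - w t) 0 i).
Proof.
move=> cu cw; apply: measurable_components => i.
rewrite (_ : (fun t => _) = (fun t => u t 0 i - w t 0 i)); last first.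
  by apply/funext => t; rewrite !mxE.
by move=> t; apply: cvgB; [exact: cu|exact: cw].
Qed.

Lemma normalized_total_curvature (S : axisphere R) :
  ((diam (surface_points S))^-1%:E * total_abs_mean_curvature S =
   (pi * ((\int[mu]_(s in `[0, gen_L S]) `|radial_curvature S s|)
           / diam (surface_points S)))%:E)%E.
Proof. by rewrite total_abs_mean_curvatureE -EFinM mulrCA (mulrC _^-1). Qed.

Lemma pi_lt_total_curvature (S : axisphere R) :
  (pi%:E < (diam (surface_points S))^-1%:E * total_abs_mean_curvature S)%E.
Proof.
rewrite normalized_total_curvature lte_fin -[ltLHS]mulr1 ltr_pM2l ?pi_gt0//.
rewrite ltr_pdivlMr ?diam_gt0// mul1r.
apply: (le_lt_trans (diam_le_length S)).
apply: lt_le_trans (integral_radial_curvature_ge S).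
by rewrite ltrDl divr_gt0// radial_energy_gt0.
Qed.

Lemma height_defect_cvg0 (S_ : nat -> axisphere R) :
  ((diam (surface_points (S_ n)))^-1%:E
     * total_abs_mean_curvature (S_ n))%E @[n --> \oo] --> (pi : R)%:E ->
  height_defect (S_ n) @[n --> \oo] --> (0 : R).
Proof.
under eq_fun do rewrite normalized_total_curvature.
move=> /fine_cvgP[_] /cvgrPdist_le /= H.
apply/cvgrPdist_le => e e0.
(* The constant 16 is that of [height_defect_le]. *)
pose k := Num.min 1 (e / 16).
have k0 : 0 < k by rewrite lt_min ltr01 divr_gt0.
have k1 : k <= 1 by rewrite ge_min lexx.
have ke : 16 * k <= e.
  by rewrite -ler_pdivlMl// mulrC ge_min lexx orbT.
have := H (pi * k ^+ 2); rewrite mulr_gt0 ?pi_gt0 ?exprn_gt0// => /(_ isT).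
apply: filterS => n; rewrite -{1}[pi]mulr1 -mulrBr normrM.
rewrite (ger0_norm (pi_ge0 R)) ler_pM2l ?pi_gt0// ler_norml => /andP[+ _].
set D := diam _; set I := Rintegral _ _ _ => ID.
have D0 : 0 < D by exact: diam_gt0.
have LD : gen_L (S_ n) + radial_energy (S_ n) / 6 <= (1 + k ^+ 2) * D.
  apply: (le_trans (integral_radial_curvature_ge (S_ n))); rewrite -/I.
  by rewrite -ler_pdivrMr//; lra.
have := height_defect_le k0 k1 LD.
have L0 := gen_L_gt0 (S_ n).
have /andP[h0 _] := height_defect_bounds (S_ n).
rewrite sub0r normrN ger0_norm// => hL; apply: le_trans ke.
by rewrite /height_defect -(@ler_pM2r _ (gen_L (S_ n)))// mulrBl mul1r divfK ?gt_eqF.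
Qed.

End Conclusion.

Theorem corollary1p4 (R : realType) :
  (forall S : axisphere R,
     (pi%:E < (diam (surface_points S))^-1%:E * total_abs_mean_curvature S)%E)
  /\
  (forall S_ : nat -> axisphere R,
     ((diam (surface_points (S_ n)))^-1%:E
        * total_abs_mean_curvature (S_ n))%E @[n --> \oo] --> (pi : R)%:E ->
     exists (T_ : nat -> 'rV[R]_3 -> 'rV[R]_3) (c_ : nat -> R -> 'rV[R]_3)
            (cbar : R -> 'rV[R]_3),
       [/\ forall n, is_similarity (T_ n),
           forall n, generating_curve (S_ n) (c_ n),
           unit_speed_segment cbar
         & forall p : R, 1 <= p -> cvg_W1p p (fun n t => T_ n (c_ n t)) cbar]).
Proof.
split=> [|S_ /height_defect_cvg0 d0]; first exact: pi_lt_total_curvature.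
pose e3 : 'rV[R]_3 := row3 0 0 1.
exists (fun n => normalize (S_ n)), (fun n => meridian (S_ n)), (fun t => t *: e3).
split=> [n|n||p p1].
- exact: normalize_similarity.
- by exists 0; left.
- exists 0, e3; split=> [|t _]; last by rewrite add0r.
  by rewrite enorm_row3 expr0n !add0r expr1n sqrtr1.
have -> : (fun n t => normalize (S_ n) (meridian (S_ n) t)) =
    (fun n => normalized_meridian (S_ n)).
  by apply/funext => n; apply/funext => t; exact: normalize_meridian.
have du n i := is_derive_continuous (normalized_meridian_is_derive (S_ n) i).
have de i (t : R) : is_derive t 1 (fun t : R => (t *: e3) 0 i) (e3 0 i).
  under eq_fun do rewrite mxE.
  by have := is_derive_mulr (e3 0 i) (is_derive_id t 1); rewrite mul1r.
have ce i := is_derive_continuous (de i).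
have ce3 i : continuous (fun _ : R => e3 0 i) by move=> t; exact: cvg_cst.
have dn2 : 2 * height_defect (S_ n) @[n --> \oo] --> (0 : R).
  by rewrite -[X in _ --> X](mulr0 2); apply: cvgMr.
exists (fun n => normalized_velocity (S_ n)), (fun=> e3); split.
- move=> n; split.
  + apply: in_Lp_bounded => //; first exact: measurable_components.
    exact: enorm_normalized_meridian.
  + apply: in_Lp_bounded => //.
      by apply: measurable_components => i; exact: normalized_velocity_continuous.
    by move=> t /(enorm_normalized_velocity (S_ n)) ->.
  + apply: C1_weak_derivative => i; first exact: normalized_meridian_is_derive.
    exact: normalized_velocity_continuous.
- split.
  + apply: in_Lp_bounded => //; first exact: measurable_components.
    move=> t; rewrite in_itv/= => /andP[t0 t1].
    rewrite row3Z enorm_row3 !mulr0 expr0n !add0r mulr1 sqrtr_sqr.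
    by rewrite ger0_norm ltW.
  + apply: in_Lp_bounded => // t _.
    by rewrite enorm_row3 expr0n !add0r expr1n sqrtr1.
  + exact: C1_weak_derivative.
- apply: (@Lp_norm_cvg0 _ _ _ (fun n _ => 2 * height_defect (S_ n))) => //.
  + by move=> n; exact: measurable_componentsB (du n) ce.
  + by move=> n t; exact: cvg_cst.
  + move=> n t tI; rewrite normalized_meridian_near//=.
    by have /andP[] := height_defect_bounds (S_ n); lra.
  + under eq_fun do rewrite Rintegral_cst//= lebesgue_measure_itv/= lte_fin ltr01
      sube0 mulr1.
    exact: dn2.
- apply: (@Lp_norm_cvg0 _ _ _ (fun n t => 2 - 2 * derive1 (gen_z (S_ n)) (gen_L (S_ n) * t)))
    => //.
  + move=> n; apply: measurable_componentsB ce3 => i.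
    exact: normalized_velocity_continuous.
  + move=> n t; apply: cvgB; first exact: cvg_cst.
    by apply: cvgMr; exact: continuous_rescale (@gen_dz_continuous _ (S_ n)) t.
  + move=> n t tI; rewrite normalized_velocity_near// lexx/=.
    have := @gen_arclength _ (S_ n) _ (scale_itv (S_ n) (subset_itv_oo_cc tI)).
    move: (derive1 (gen_x _) _) (derive1 (gen_z _) _) => a b ab.
    have : b ^+ 2 <= 1 by have := sqr_ge0 a; lra.
    rewrite -(expr1n _ 2) -[leLHS]real_normK ?num_real// ler_pXn2r ?nnegrE//.
    by rewrite ler_norml => /andP[]; lra.
  + under eq_fun do rewrite integral_velocity_defect.
    exact: dn2.
Qed.
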